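(* Let $X:\Omega\to\mathbb{C}^{N\times m}$ be a solution of the Grassmannian sigma model equations with associated surface $Z:\Omega\to\mathfrak{su}(N)$, and let $\det G\ne 0$ on a neighborhood $\Upsilon\subset\Omega$ of a point $(\xi_L^0,\xi_R^0)$. Let $n_3,\ldots,n_{N^2-1}:\Upsilon\to\mathfrak{su}(N)$ be smooth and satisfy $$(\partial_L Z,n_k)=(\partial_R Z,n_k)=0,\qquad (n_j,n_k)=\delta_{jk}\qquad (j,k=3,\ldots,N^2-1).$$ Then there are real-valued functions $H_j,Q^L_j,Q^R_j,s^L_{jk},s^R_{jk}$ on $\Upsilon$ with $s^L_{jk}+s^L_{kj}=0$, $s^R_{jk}+s^R_{kj}=0$ such that the moving frame $(\partial_L Z,\partial_R Z,n_3,\ldots,n_{N^2-1})$ satisfies the Gauss--Weingarten equations (summation over repeated lower-case indices from $3$ to $N^2-1$) $$\begin{aligned} \partial_L\partial_L Z&=A^L_L\,\partial_L Z+A^L_R\,\partial_R Z+Q^L_j n_j,\\ \partial_L\partial_R Z&=\partial_R\partial_L Z=H_j n_j,\\ \partial_R\partial_R Z&=A^R_L\,\partial_L Z+A^R_R\,\partial_R Z+Q^R_j n_j,\\ \partial_L n_j&=\alpha^L_j\,\partial_L Z+\beta^L_j\,\partial_R Z+s^L_{jk}n_k,\\ \partial_R n_j&=\alpha^R_j\,\partial_L Z+\beta^R_j\,\partial_R Z+s^R_{jk}n_k, \end{aligned}$$ where $$\alpha^L_j=\frac{H_jG_{LR}-Q^L_jJ_R}{\det G},\quad \beta^L_j=\frac{Q^L_jG_{LR}-H_jJ_L}{\det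 G},\quad \alpha^R_j=\frac{Q^R_jG_{LR}-H_jJ_R}{\det G},\quad \beta^R_j=\frac{H_jG_{LR}-Q^R_jJ_L}{\det G},$$ $$A^L_L=\frac{J_R(\partial_L\partial_L Z,\partial_L Z)-G_{LR}(\partial_L\partial_L Z,\partial_R Z)}{\det G},\qquad A^L_R=\frac{J_L(\partial_L\partial_L Z,\partial_R Z)-G_{LR}(\partial_L\partial_L Z,\partial_L Z)}{\det G},$$ $$A^R_R=\frac{J_L(\partial_R\partial_R Z,\partial_R Z)-G_{LR}(\partial_R\partial_R Z,\partial_L Z)}{\det G},\qquad A^R_L=\frac{J_R(\partial_R\partial_R Z,\partial_L Z)-G_{LR}(\partial_R\partial_R Z,\partial_R Z)}{\det G},$$ and, for $B,D\in\{L,R\}$ (no summation), $$(\partial_B\partial_B Z,\partial_D Z)=\left(\delta_{B,D}-\tfrac12\right)\operatorname{tr}\Big((\partial_B\partial_B X\,\partial_D X^\dagger+\partial_D X\,\partial_B\partial_B X^\dagger)P+2\,\partial_B X\,\partial_B X^\dagger\,(X\,\partial_D X^\dagger+\partial_D X\,X^\dagger)\Big).$$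
   Context: Let $m,n\ge 1$ and $N=m+n$. Let $\Omega\subset\mathbb{R}^2$ be open, connected and simply connected, with light-cone coordinates $\xi_L=\xi^0+\xi^1$, $\xi_R=\xi^0-\xi^1$, and write $\partial_L=\partial/\partial\xi_L$, $\partial_R=\partial/\partial\xi_R$. A dagger denotes the conjugate transpose; derivatives of $X^\dagger$ are written $\partial_D X^\dagger=\partial_D(X^\dagger)$, $\partial_B\partial_B X^\dagger=\partial_B\partial_B(X^\dagger)$. A smooth map $X:\Omega\to\mathbb{C}^{N\times m}$ with $X^\dagger X=\mathbf{1}_{m\times m}$ represents a map into the Grassmannian $G(m,n)=SU(N)/S(U(m)\times U(n))$. Put $P=\mathbf{1}-XX^\dagger$, an orthogonal projector. $X$ is called a solution of the Grassmannian sigma model (Euler--Lagrange) equations if $[\partial_L\partial_R P,P]=0$ on $\Omega$, equivalently $\partial_L[\partial_R P,P]+\partial_R[\partial_L P,P]=0$. The algebra $\mathfrak{su}(N)$ of traceless anti-Hermitian $N\times N$ matrices is equipped with the scalar product $(A,B)=-\frac12\operatorname{tr}(AB)$ and so identified with Euclidean space $\mathbb{R}^{N^2-1}$. For a solution $X$, the associated surface is the smooth map $Z:\Omega\to\mathfrak{su}(N)$, unique up to an additive constant, with $$\partial_L Z=[\partial_L P,P],\qquad \partial_R Z=-[\partial_R P,P].$$ The induced metric is $G=\begin{pmatrix}J_L&G_{LR}\\ G_{LR}&J_R\end{pmatrix}$ with $$J_D=(\partial_D Z,\partial_D Z)=\operatorname{tr}(\partial_D X\,\partial_D X^\dagger P)\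 (D=L,R),\qquad G_{LR}=(\partial_L Z,\partial_R Z)=-\tfrac12\operatorname{tr}\big((\partial_L X\,\partial_R X^\dagger+\partial_R X\,\partial_L X^\dagger)P\big),$$ and $\det G=J_LJ_R-G_{LR}^2$. *)

(* Defs.v *)
From HB Require Import structures.
From mathcomp Require Import all_boot all_order all_algebra.
From mathcomp Require Import all_classical all_reals all_analysis.
From mathcomp Require Import complex.

Set Implicit Arguments.
Unset Strict Implicit.
Unset Printing Implicit Defensive.

Import Order.TTheory GRing.Theory Num.Theory.
Import numFieldNormedType.Exports.

Local Open Scope classical_set_scope.
Local Open Scope sesquilinear_scope.
Local Open Scope complex_scope.
Local Open Scope ring_scope.

(* Points are given by their coordinates (xi^0, xi^1). *)
Definition plane (R : realType) : normedModType R := (R * R)%type.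

(* The point with light-cone coordinates xi_L = a, xi_R = b, where
   xi_L = xi^0 + xi^1 and xi_R = xi^0 - xi^1. *)
Definition light_cone {R : realType} (a b : R) : plane R :=
  ((a + b) / 2, (a - b) / 2).

(* The index set {L, R} is encoded by bool, with L = true and R = false.
   light_cone is linear, so the partial derivative with respect to xi_L
   (resp. xi_R) is the directional derivative along light_cone 1 0
   (resp. light_cone 0 1). *)
Definition lc_dir {R : realType} (B : bool) : plane R :=
  if B then light_cone 1 0 else light_cone 0 1.

Definition simply_connected {R : realType} (U : set (plane R)) : Prop :=
  forall gamma : R -> plane R,
    {within `[0, 1], continuous gamma} ->
    (forall t, t \in `[0, 1] -> U (gamma t)) ->
    gamma 0 = gamma 1 ->
    exists h : R * R -> plane R,
      [/\ {within `[0, 1] `*` `[0, 1], continuous h},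
          forall s t, s \in `[0, 1] -> t \in `[0, 1] -> U (h (s, t)),
          forall t, t \in `[0, 1] -> h (0, t) = gamma t,
          forall t, t \in `[0, 1] -> h (1, t) = gamma 0 &
          forall s, s \in `[0, 1] -> h (s, 0) = gamma 0 /\ h (s, 1) = gamma 0].

Fixpoint Ck {R : realType} (k : nat) (U : set (plane R)) (f : plane R -> R) :
    Prop :=
  match k with
  | 0%N => forall p, U p -> {for p, continuous f}
  | k'.+1 => (forall p, U p -> differentiable f p) /\
             (forall v, Ck k' U ('D_v f))
  end.

(* Matrix-valued maps are differentiated entrywise, real and imaginary parts
   separately; they are total functions whose values outside the open set
   under consideration are irrelevant. *)
Definition smooth_mx {R : realType} {a b : nat} (U : set (plane R))
    (F : plane R -> 'M[R[i]]_(a, b)) : Prop :=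
  forall i j k, Ck k U (fun p => complex.Re (F p i j)) /\
                Ck k U (fun p => complex.Im (F p i j)).

Definition pd {R : realType} {a b : nat} (B : bool)
    (F : plane R -> 'M[R[i]]_(a, b)) (p : plane R) : 'M[R[i]]_(a, b) :=
  \matrix_(i, j) ('D_(lc_dir B) (fun q => complex.Re (F q i j)) p +i*
                  'D_(lc_dir B) (fun q => complex.Im (F q i j)) p).

Notation dL := (pd true).
Notation dR := (pd false).

Definition dagger {R : realType} {a b : nat} (F : plane R -> 'M[R[i]]_(a, b))
    (p : plane R) : 'M[R[i]]_(b, a) := (F p) ^t*.

Definition bracket {R : realType} {N : nat} (A B : 'M[R[i]]_N) : 'M[R[i]]_N :=
  A *m B - B *m A.

Definition su {R : realType} {N : nat} (A : 'M[R[i]]_N) : Prop :=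
  A ^t* = - A /\ \tr A = 0.

(* The formula is complex-valued; its values are real for A and B in su(N). *)
Definition sp {R : realType} {N : nat} (A B : 'M[R[i]]_N) : R[i] :=
  - (2^-1) * \tr (A *m B).

Definition gproj {R : realType} {N m : nat} (X : plane R -> 'M[R[i]]_(N, m))
    (p : plane R) : 'M[R[i]]_N := 1%:M - X p *m dagger X p.

Definition sigma_solution {R : realType} {N m : nat} (Omega : set (plane R))
    (X : plane R -> 'M[R[i]]_(N, m)) : Prop :=
  [/\ smooth_mx Omega X,
      forall p, Omega p -> dagger X p *m X p = 1%:M &
      forall p, Omega p -> bracket (dL (dR (gproj X)) p) (gproj X p) = 0].

Definition associated_surface {R : realType} {N m : nat}
    (Omega : set (plane R)) (X : plane R -> 'M[R[i]]_(N, m))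
    (Z : plane R -> 'M[R[i]]_N) : Prop :=
  [/\ smooth_mx Omega Z,
      forall p, Omega p -> su (Z p),
      forall p, Omega p -> dL Z p = bracket (dL (gproj X) p) (gproj X p) &
      forall p, Omega p -> dR Z p = - bracket (dR (gproj X) p) (gproj X p)].

Definition JL {R : realType} {N : nat} (Z : plane R -> 'M[R[i]]_N) p : R[i] :=
  sp (dL Z p) (dL Z p).

Definition JR {R : realType} {N : nat} (Z : plane R -> 'M[R[i]]_N) p : R[i] :=
  sp (dR Z p) (dR Z p).

Definition GLR {R : realType} {N : nat} (Z : plane R -> 'M[R[i]]_N) p : R[i] :=
  sp (dL Z p) (dR Z p).

Definition detG {R : realType} {N : nat} (Z : plane R -> 'M[R[i]]_N) p : R[i] :=
  JL Z p * JR Z p - GLR Z p ^+ 2.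

(* A^L_L, A^L_R, A^R_R, A^R_L: the first letter of the suffix is the upper
   index, the second the lower. *)
Definition ALL {R : realType} {N : nat} (Z : plane R -> 'M[R[i]]_N) p : R[i] :=
  (JR Z p * sp (dL (dL Z) p) (dL Z p) - GLR Z p * sp (dL (dL Z) p) (dR Z p))
    / detG Z p.

Definition ALR {R : realType} {N : nat} (Z : plane R -> 'M[R[i]]_N) p : R[i] :=
  (JL Z p * sp (dL (dL Z) p) (dR Z p) - GLR Z p * sp (dL (dL Z) p) (dL Z p))
    / detG Z p.

Definition ARR {R : realType} {N : nat} (Z : plane R -> 'M[R[i]]_N) p : R[i] :=
  (JL Z p * sp (dR (dR Z) p) (dR Z p) - GLR Z p * sp (dR (dR Z) p) (dL Z p))
    / detG Z p.

Definition ARL {R : realType} {N : nat} (Z : plane R -> 'M[R[i]]_N) p : R[i] :=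
  (JR Z p * sp (dR (dR Z) p) (dL Z p) - GLR Z p * sp (dR (dR Z) p) (dR Z p))
    / detG Z p.

(* Number of normal vectors; i : 'I_(codim N) stands for the index i + 3 in
   3, ..., N^2 - 1. *)
Definition codim (N : nat) : nat := (N ^ 2 - 3)%N.

(* Main.v *)
Require Import Defs.
From HB Require Import structures.
From mathcomp Require Import all_boot all_order all_algebra.
From mathcomp Require Import all_classical all_reals all_analysis.
From mathcomp Require Import complex ring.

Set Implicit Arguments.
Unset Strict Implicit.
Unset Printing Implicit Defensive.

Import Order.TTheory GRing.Theory Num.Theory.
Import numFieldNormedType.Exports.

Local Open Scope classical_set_scope.
Local Open Scope complex_scope.
Local Open Scope ring_scope.

(** Along a solution, [dL Z] and [dR Z] are, up to sign, the tangent matrices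
    [P B X^* - X B^* P] with [B] a first derivative of [X]; the metric and the
    products of second derivatives of [Z] with the tangent vectors are trace
    computations with [P X = 0], [X^* P = 0] and the derivative of
    [X^* X = 1].  The Euler-Lagrange equation turns the mixed derivative into
    [dL dR Z = [dL P, dR P]]: both factors are off-diagonal with respect to
    [P], so this commutator commutes with [P] and is orthogonal to every
    [[dD P, P]].

    The frame together with the identity has [N^2] elements and a
    nondegenerate Gram matrix for the trace form, so it is a basis of the
    complex matrices.  Expanding a traceless matrix in it by scalar products
    gives every Gauss-Weingarten equation once the orthogonality relations of
    the frame have been differentiated. *)

(** * Symmetry of second derivatives *)

Lemma is_derive_line (R : realType) (V : normedModType R) (f : V -> R)
    (a u : V) (s : R) :
  derivable f (a + s *: u) u ->
  is_derive s 1 (fun t : R => f (a + t *: u)) ('D_u f (a + s *: u)).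
Proof.
have E : (fun h : R => h^-1 *: (((fun t : R => f (a + t *: u)) \o shift s)
            (h *: 1) - f (a + s *: u))) =
         (fun h => h^-1 *: ((f \o shift (a + s *: u)) (h *: u)
            - f (a + s *: u))).
  rewrite funeqE => h /=; rewrite [h *: 1]mulr1 scalerDl.
  by rewrite (addrC (h *: u)) addrA (addrC _ (h *: u)).
move=> df; apply: DeriveDef; first by rewrite /derivable E.
by rewrite /derive E.
Qed.

(** The mean value theorem for [s |-> f (a + s *: u) - f (b + s *: u)]. Comparing two parallel
    segments at one common parameter [c] turns a second difference into a difference of first
    derivatives. *)
Lemma mvt_line (R : realType) (V : normedModType R) (f : V -> R)
    (a b u : V) (t : R) :
  0 < t ->
  (forall s, 0 <= s <= t -> derivable f (a + s *: u) u) ->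
  (forall s, 0 <= s <= t -> derivable f (b + s *: u) u) ->
  exists2 c, 0 <= c <= t &
    (f (a + t *: u) - f (b + t *: u)) - (f a - f b) =
    ('D_u f (a + c *: u) - 'D_u f (b + c *: u)) * t.
Proof.
move=> t0 da db.
pose phi := (fun s : R => f (a + s *: u)) - (fun s : R => f (b + s *: u)).
have dphi s : 0 <= s <= t ->
    is_derive s 1 phi ('D_u f (a + s *: u) - 'D_u f (b + s *: u)).
  move=> st; apply: is_deriveB; first exact: is_derive_line (da _ st).
  exact: is_derive_line (db _ st).
have [||c ct] := @MVT R phi
  (fun s => 'D_u f (a + s *: u) - 'D_u f (b + s *: u)) 0 t t0.
- move=> s; rewrite in_itv /= => /andP[s0 st]; apply: dphi.
  by rewrite !ltW.
- apply: derivable_within_continuous => s; rewrite in_itv /= => st.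
  by have [] := dphi s st.
rewrite subr0 /phi !fctE !scale0r !addr0 => E; exists c => //.
by move: ct; rewrite in_itv /= => /andP[/ltW -> /ltW ->].
Qed.

Lemma differentiable_bound (R : realType) (V : normedModType R) (g : V -> R)
    (p : V) :
  differentiable g p -> forall e, 0 < e ->
  \forall h \near (0 : V), `|g (p + h) - g p - 'd g p h| <= e * `|h|.
Proof.
move=> dg e e0.
have /eqaddoP /(_ e e0) := diff_locally dg.
apply: filterS => h /=.
by rewrite !fctE /= (addrC h p) opprD addrA.
Qed.

Definition second_difference (R : realType) (V : normedModType R) (f : V -> R)
    (p u v : V) (t : R) : R :=
  f (p + t *: u + t *: v) - f (p + t *: u) - f (p + t *: v) + f p.

Lemma second_differenceC (R : realType) (V : normedModType R) (f : V -> R)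
    (p u v : V) : second_difference f p u v = second_difference f p v u.
Proof.
apply/funext => t; rewrite /second_difference; congr (_ + _).
by rewrite addrAC (addrAC p).
Qed.

(** By [mvt_line] the second difference is [t] times the difference of ['D_u f] at two points near
    [p]. Linearizing ['D_u f] at [p] gives the main term, and the two remainders are of size o(t)
    each. *)
Lemma second_difference_bound (R : realType) (V : normedModType R) (f : V -> R)
    (p u v : V) :
  (\forall q \near p, differentiable f q) ->
  differentiable ('D_u f) p ->
  forall e, 0 < e -> \forall t \near 0^'+,
    `|second_difference f p u v t - 'D_v ('D_u f) p * t ^+ 2| <= e * t ^+ 2.
Proof.
move=> df dg e e0.
(* [t * M] bounds every displacement [s *: u + s' *: v] with [s], [s'] between 0 and [t]; the
   summand 1 keeps [M] positive when [u = v = 0]. With [e' = e / (2 * M)] the two remainders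
   together are at most [e * t]. *)
pose M := `|u| + `|v| + 1.
have M0 : 0 < M by rewrite ltr_wpDl // addr_ge0.
pose e' := e / (2 * M).
have e'0 : 0 < e' by rewrite divr_gt0 // mulr_gt0.
have /nbhs_norm0P [d1 /= d10 H1] := differentiable_bound dg e'0.
have /nbhs_normP [d2 /= d20 H2] := df.
have near_p h : `|h| < d2 -> differentiable f (p + h).
  by move=> hd; apply: H2; rewrite /ball_ /= opprD addNKr normrN.
near=> t.
have t0 : 0 < t by near: t; exact: nbhs_right_gt.
have tM1 : t * M < d1.
  rewrite -ltr_pdivlMr //; near: t; apply: nbhs_right_lt; exact: divr_gt0.
have tM2 : t * M < d2.
  rewrite -ltr_pdivlMr //; near: t; apply: nbhs_right_lt; exact: divr_gt0.
have bd s s' : 0 <= s <= t -> 0 <= s' <= t -> `|s *: u + s' *: v| <= t * M.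
  move=> /andP[s0 st] /andP[s'0 s't].
  rewrite (le_trans (ler_normD _ _)) // !normrZ !ger0_norm // /M !mulrDr.
  apply: ler_wpDr; first by rewrite mulr1 ltW.
  by apply: lerD; exact: ler_wpM2r.
have tt : 0 <= t <= t by rewrite lexx ltW.
have z0t : 0 <= (0 : R) <= t by rewrite lexx ltW.
have [||c ct E] := @mvt_line R V f (p + t *: v) p u t t0.
- move=> s st; apply: diff_derivable; rewrite -addrA (addrC (t *: v)).
  by apply: near_p; exact: le_lt_trans (bd _ _ st tt) tM2.
- move=> s st; apply: diff_derivable; apply: near_p.
  by have := le_lt_trans (bd _ _ st z0t) tM2; rewrite scale0r addr0.
have -> : second_difference f p u v t =
    f (p + t *: v + t *: u) - f (p + t *: u) - (f (p + t *: v) - f p).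
  rewrite /second_difference (addrAC p).
  by move: (f _) (f _) (f _) (f _) => w1 w2 w3 w4; rewrite !opprB !addrA addrAC.
rewrite E.
have b1 := bd c t ct tt.
have b2 := bd c 0 ct z0t; rewrite scale0r addr0 in b2.
have := H1 _ (le_lt_trans b1 tM1); have := H1 _ (le_lt_trans b2 tM1).
rewrite /=.
set h1 := c *: u + t *: v in b1 *; set h2 := c *: u in b2 *.
have -> : p + t *: v + h2 = p + h1 by rewrite /h1 /h2 -addrA (addrC (t *: v)).
(* Since [h1 - h2 = t *: v], the linear parts produce exactly the main term, and only the remainders
   at [h1] and [h2] are left to estimate. *)
have L : 'd ('D_u f) p h1 - 'd ('D_u f) p h2 = t * 'D_v ('D_u f) p.
  by rewrite -linearB /h1 /h2 addrAC subrr add0r linearZ (deriveE _ dg).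
move: L.
set x1 := 'd _ p h1; set x2 := 'd _ p h2; set D := 'D_v _ p.
set g1 := 'D_u f (p + h1); set g2 := 'D_u f (p + h2); set g0 := 'D_u f p.
move=> L I2 I1.
have -> : (g1 - g2) * t - D * t ^+ 2 = ((g1 - g0 - x1) - (g2 - g0 - x2)) * t.
  rewrite expr2 mulrA -mulrBl (mulrC D) -L.
  by move: (x1) (x2) (g1) (g2) (g0) (t) => *; ring.
rewrite normrM (gtr0_norm t0) expr2 mulrA ler_wpM2r ?(ltW t0) //.
rewrite (le_trans (ler_normB _ _)) // (le_trans (lerD I1 I2)) //.
rewrite -mulrDr.
apply: (@le_trans _ _ (e' * (2 * (t * M)))).
  by rewrite ler_wpM2l ?(ltW e'0) // mulr_natl mulr2n lerD.
rewrite /e' le_eqVlt; apply/orP; left; apply/eqP.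
by field; rewrite gt_eqF.
Unshelve. all: by end_near. Qed.

(* Both mixed derivatives are the limit of the second difference over t^2. *)
Lemma derive_comm (R : realType) (V : normedModType R) (f : V -> R)
    (p u v : V) :
  (\forall q \near p, differentiable f q) ->
  differentiable ('D_u f) p -> differentiable ('D_v f) p ->
  'D_u ('D_v f) p = 'D_v ('D_u f) p.
Proof.
move=> df du dv; apply/eqP; rewrite -subr_eq0 -normr_le0.
apply/ler_addgt0Pr => e e0; rewrite add0r.
have e20 : 0 < e / 2 by rewrite divr_gt0.
have N1 := second_difference_bound v df du e20.
have N2 := second_difference_bound u df dv e20.
rewrite (second_differenceC f p v u) in N2.
have [t [[I1 I2] /= t0]] := @filter_ex _ _ (at_right_proper_filter (0 : R)) _
  (filterI (filterI N1 N2) (nbhs_right_gt (0 : R))).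
have t20 : 0 < t ^+ 2 by exact: exprn_gt0.
move: I1 I2 t20; move: (second_difference _ _ _ _ _) (t ^+ 2) => x w.
move: ('D_u _ _) ('D_v _ _) => a b I1 I2 w0.
rewrite -(ler_pM2r w0) -[w in `|_| * w]gtr0_norm // -normrM.
have -> : (a - b) * w = (x - b * w) - (x - a * w) by ring.
rewrite (le_trans (ler_normB _ _)) // (le_trans (lerD I1 I2)) //.
by rewrite -mulrDl -splitr.
Qed.

(** * Algebra of the tangent matrices *)

Section ProjectorAlgebra.
Variables (F : comRingType) (N m : nat).
Variables (P : 'M[F]_N) (X : 'M[F]_(N, m)) (Y : 'M[F]_(m, N)).

(** The value of [[dP, P]] when [B] and [B'] are the derivatives of [X] and of its dagger [Y].
    Keeping [B] and [B'] independent removes conjugation from the algebra, which then rests on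
    [Y *m X = 1] and the derivatives of that identity. *)
Definition tangent (B : 'M[F]_(N, m)) (B' : 'M[F]_(m, N)) : 'M[F]_N :=
  P *m B *m Y - X *m B' *m P.

Hypotheses (YX : Y *m X = 1%:M) (defP : P = 1%:M - X *m Y).

Let PX : P *m X = 0.
Proof. by rewrite defP mulmxBl mul1mx -mulmxA YX mulmx1 subrr. Qed.

Let YP : Y *m P = 0.
Proof. by rewrite defP mulmxBr mulmx1 mulmxA YX mul1mx subrr. Qed.

Let PXr k (C : 'M[F]_(k, N)) : C *m P *m X = 0.
Proof. by rewrite -mulmxA PX mulmx0. Qed.

Let YPr k (C : 'M[F]_(k, m)) : C *m Y *m P = 0.
Proof. by rewrite -mulmxA YP mulmx0. Qed.

Let YXr k (C : 'M[F]_(k, m)) : C *m Y *m X = C.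
Proof. by rewrite -mulmxA YX mulmx1. Qed.

Let PP : P *m P = P.
Proof. by rewrite {2}defP mulmxBr mulmx1 mulmxA PX mul0mx subr0. Qed.

Let PPr k (C : 'M[F]_(k, N)) : C *m P *m P = C *m P.
Proof. by rewrite -mulmxA PP. Qed.

Lemma bracket_tangent B B' :
  - (B *m Y + X *m B') *m P - P *m (- (B *m Y + X *m B')) = tangent B B'.
Proof.
rewrite mulNmx mulmxN opprK mulmxDl mulmxDr !mulmxA YPr PX mul0mx add0r addr0.
by rewrite addrC /tangent.
Qed.

(** Of the four products, two contain [Y *m P] or [P *m X] and vanish; cyclicity of the trace brings
    the other two to the stated form. *)
Lemma tr_tangentM B B' D D' :
  \tr (tangent B B' *m tangent D D') = - \tr ((B *m D' + D *m B') *m P).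
Proof.
rewrite /tangent mulmxBl !mulmxBr !mulmxA YPr !mul0mx PXr !mul0mx.
rewrite sub0r subr0 YXr PPr -opprD mulmxDl !mxtraceD raddfN /= mxtraceD.
congr (- (_ + _)).
  by rewrite mxtrace_mulC !mulmxA PP -mulmxA mxtrace_mulC.
rewrite mxtrace_mulC !mulmxA YX mul1mx -mulmxA mxtrace_mulC -mulmxA.
by rewrite mxtrace_mulC.
Qed.

(* [B, B'] and [B2, B2'] stand for first and second derivatives of [X, Y]:
   this is the derivative of [tangent B B'] by the product rule. *)
Definition dtangent (B : 'M[F]_(N, m)) (B' : 'M[F]_(m, N))
    (B2 : 'M[F]_(N, m)) (B2' : 'M[F]_(m, N)) : 'M[F]_N :=
  let dP := - (B *m Y + X *m B') in
  (dP *m B + P *m B2) *m Y + P *m B *m B'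
  - ((B *m B' + X *m B2') *m P + X *m B' *m dP).

(** A trace against [tangent D D'] sees only the blocks [Y *m S *m P] and [P *m S *m X] of the
    differentiated matrix [S]. In each block the first-derivative term occurs twice, once directly
    and once through the derivative of [P]; the constraint on [B], [B'] identifies the two copies,
    whence the factor 2. *)
Lemma tr_dtangentM B B' B2 B2' D D' :
  Y *m B + B' *m X = 0 -> Y *m D + D' *m X = 0 ->
  \tr (dtangent B B' B2 B2' *m tangent D D') =
  - \tr ((B2 *m D' + D *m B2') *m P
         + 2 *: (B *m B' *m (X *m D' + D *m Y))).
Proof.
move=> HB HD.
have BX : B' *m X = - (Y *m B) by apply/eqP; rewrite -addr_eq0 addrC HB.
have YB : Y *m B = - (B' *m X) by apply/eqP; rewrite -addr_eq0 HB.
have DX : D' *m X = - (Y *m D) by apply/eqP; rewrite -addr_eq0 addrC HD.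
pose S := dtangent B B' B2 B2'.
have S1 : Y *m S *m P = - (2 *: (Y *m B *m B' *m P) + B2' *m P).
  rewrite /S /dtangent !(mulmxDr, mulmxDl, mulmxBr, mulmxBl, mulmxN, mulNmx).
  rewrite !mulmxA.
  rewrite !YPr !(YP, YX, mul0mx, mul1mx) BX !PPr !mulNmx.
  by rewrite !(addr0, add0r, oppr0) opprK scaler_nat mulr2n addrAC.
have S2 : P *m S *m X = 2 *: (P *m B *m B' *m X) + P *m B2.
  rewrite /S /dtangent !(mulmxDr, mulmxDl, mulmxBr, mulmxBl, mulmxN, mulNmx).
  rewrite !mulmxA.
  rewrite !PXr !(PX, YX, mul0mx, mul1mx) !YXr PP.
  rewrite -(mulmxA _ Y B) YB.
  rewrite !(addr0, subr0) mulmxN opprK mulmxA scaler_nat mulr2n.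
  by rewrite addrAC.
(* The constraint on [D], [D'] cancels the two terms [X *m Y *m D *m Y] and [X *m D' *m X *m Y] that
   come from expanding [P]. *)
have PD : P *m D *m Y + X *m D' *m P = X *m D' + D *m Y.
  rewrite defP !(mulmxBl, mulmxBr) mul1mx mulmx1 !mulmxA.
  rewrite -(mulmxA X D') DX mulmxN mulNmx opprK !mulmxA addrACA.
  by rewrite addNr addr0 addrC.
have -> : \tr (S *m tangent D D') =
    \tr (Y *m S *m P *m D) - \tr (P *m S *m X *m D').
  rewrite /tangent mulmxBr raddfB /= !mulmxA mxtrace_mulC !mulmxA.
  by rewrite [X in _ - X]mxtrace_mulC !mulmxA.
rewrite S1 S2 -PD !mulmxDl mulNmx !mulmxDl -!scalemxAl.
rewrite !(raddfD, raddfN) /= !mxtraceZ.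
have -> : \tr (Y *m B *m B' *m P *m D) = \tr (B *m B' *m (P *m D *m Y)).
  by rewrite -!mulmxA mxtrace_mulC !mulmxA.
have -> : \tr (P *m B *m B' *m X *m D') = \tr (B *m B' *m (X *m D' *m P)).
  by rewrite -!mulmxA mxtrace_mulC !mulmxA.
have -> : \tr (B2' *m P *m D) = \tr (D *m B2' *m P).
  by rewrite mxtrace_mulC !mulmxA.
have -> : \tr (P *m B2 *m D') = \tr (B2 *m D' *m P).
  by rewrite -mulmxA mxtrace_mulC.
ring.
Qed.

(** The algebraic counterpart of differentiating [P *m P = P], obtained here from the derivative of
    [Y *m X = 1]. *)
Lemma tangent_offdiag B B' : Y *m B + B' *m X = 0 ->
  let A := - (B *m Y + X *m B') in A *m P + P *m A = A.
Proof.
move=> HB /=; rewrite mulNmx mulmxN mulmxDl mulmxDr !mulmxA YPr PX mul0mx.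
rewrite add0r addr0 defP mulmxBr mulmx1 !mulmxBl mul1mx.
rewrite -opprD; congr (- _).
have BX : B' *m X = - (Y *m B) by apply/eqP; rewrite -addr_eq0 addrC HB.
rewrite !mulmxA -(mulmxA X B') BX mulmxN mulNmx opprK mulmxA.
by rewrite addrACA addrN addr0 addrC.
Qed.

End ProjectorAlgebra.

(** Moving [P] across an off-diagonal factor replaces it by [1 - P], so moving it across a product
    of two such factors gives [P] back. *)
Lemma offdiag_bracket_comm (F : comRingType) N (P A C : 'M[F]_N) :
  A *m P + P *m A = A -> C *m P + P *m C = C ->
  (A *m C - C *m A) *m P = P *m (A *m C - C *m A).
Proof.
have E (U V : 'M[F]_N) : U *m P + P *m U = U -> V *m P + P *m V = V ->
    U *m V *m P = P *m (U *m V).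
  move=> HU HV; rewrite -mulmxA.
  have -> : V *m P = V - P *m V by rewrite -{2}HV addrK.
  have -> : P *m (U *m V) = (U - U *m P) *m V.
    by rewrite mulmxA; congr (_ *m V); rewrite -{2}HU addrAC addrN add0r.
  by rewrite mulmxBr mulmxBl !mulmxA.
by move=> HA HC; rewrite mulmxBl mulmxBr !E.
Qed.

Lemma tr_commute_bracket (F : comRingType) N (P M E : 'M[F]_N) :
  M *m P = P *m M -> \tr (M *m (E *m P - P *m E)) = 0.
Proof.
move=> MP; rewrite mulmxBr raddfB /= !mulmxA MP.
by rewrite mxtrace_mulC mulmxA subrr.
Qed.

(** * Expansion in a frame of su(N) *)

Lemma sym2_kernel (F : idomainType) (a b x y z : F) :
  x * z - y ^+ 2 != 0 -> a * x + b * y = 0 -> a * y + b * z = 0 ->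
  a = 0 /\ b = 0.
Proof.
move=> d0 E1 E2; split; apply: (mulIf d0); rewrite mul0r.
- have -> : a * (x * z - y ^+ 2) = (a * x + b * y) * z - (a * y + b * z) * y.
    by ring.
  by rewrite E1 E2 !mul0r subrr.
- have -> : b * (x * z - y ^+ 2) = (a * y + b * z) * x - (a * x + b * y) * y.
    by ring.
  by rewrite E1 E2 !mul0r subrr.
Qed.

(** The Gram condition is used twice: it makes the family linearly independent, hence a basis by the
    count of its elements, and it then annihilates the coefficients of [A] in that basis. *)
Lemma trace_form_generates (F : fieldType) (N : nat) (I : finType)
    (e : I -> 'M[F]_N) :
  #|I| = (N * N)%N ->
  (forall c : I -> F, (forall i, \sum_j c j * \tr (e i *m e j) = 0) ->
     forall i, c i = 0) ->
  forall A, (forall i, \tr (A *m e i) = 0) -> A = 0.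
Proof.
move=> cardI gram A Ae.
pose W := \matrix_(j < #|I|) mxvec (e (enum_val j))^T.
have combE (c : 'rV_(#|I|)) :
    c *m W = mxvec (\sum_j c 0 (enum_rank j) *: e j)^T.
  rewrite mulmx_sum_row (reindex enum_rank) /=; last first.
    by apply: onW_bij; exact: enum_rank_bij.
  rewrite linear_sum linear_sum; apply: eq_bigr => j _.
  by rewrite rowK enum_rankK !linearZ.
have freeW : row_free W.
  rewrite -kermx_eq0; apply/eqP/row_matrixP => k; rewrite row0.
  set c := row k _.
  have : c *m W = 0 by rewrite /c -row_mul mulmx_ker row0.
  rewrite combE => /eqP; rewrite mxvec_eq0 trmx_eq0 => /eqP c0.
  apply/rowP => j; rewrite [RHS]mxE -(enum_valK j).
  apply: (gram (fun j => c 0 (enum_rank j))) => i.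
  rewrite -[RHS](mxtrace0 F N) -(mulmx0 N (e i)) -c0 mulmx_sumr raddf_sum /=.
  by apply: eq_bigr => j' _; rewrite -scalemxAr mxtraceZ.
have fullW : row_full W by rewrite /row_full (eqP freeW) cardI.
have /submxP [c] := submx_full (mxvec A^T) fullW.
rewrite combE => /(can_inj mxvecK) /trmx_inj EA.
have c0 : forall j, c 0 (enum_rank j) = 0.
  apply: (gram (fun j => c 0 (enum_rank j))) => i.
  rewrite -[RHS](Ae i) EA mulmx_suml raddf_sum /=.
  by apply: eq_bigr => j _; rewrite -scalemxAl mxtraceZ mxtrace_mulC.
by rewrite EA big1 // => j _; rewrite c0 scale0r.
Qed.

Lemma sp_sym (R : realType) N (A B : 'M[R[i]]_N) : sp A B = sp B A.
Proof. by rewrite /sp mxtrace_mulC. Qed.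

Lemma spDl (R : realType) N (A B C : 'M[R[i]]_N) :
  sp (A + B) C = sp A C + sp B C.
Proof. by rewrite /sp mulmxDl mxtraceD mulrDr. Qed.

Lemma spZl (R : realType) N k (A C : 'M[R[i]]_N) : sp (k *: A) C = k * sp A C.
Proof. by rewrite /sp -scalemxAl mxtraceZ mulrCA. Qed.

Lemma spNl (R : realType) N (A C : 'M[R[i]]_N) : sp (- A) C = - sp A C.
Proof. by rewrite -scaleN1r spZl mulN1r. Qed.

Lemma spNr (R : realType) N (A C : 'M[R[i]]_N) : sp A (- C) = - sp A C.
Proof. by rewrite sp_sym spNl sp_sym. Qed.

Lemma sp_suml (R : realType) N (I : finType) (F : I -> 'M[R[i]]_N) C :
  sp (\sum_j F j) C = \sum_j sp (F j) C.
Proof. by rewrite /sp mulmx_suml raddf_sum mulr_sumr. Qed.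

Lemma mxtrace_sp (R : realType) N (A B : 'M[R[i]]_N) :
  \tr (A *m B) = - 2 * sp A B.
Proof. by rewrite /sp mulrA mulrNN mulfV ?mul1r // pnatr_eq0. Qed.

(** Conjugating the trace of [A *m B] gives the trace of the daggers in reverse order; the two signs
    from anti-Hermiticity cancel, and cyclicity restores the order. *)
Lemma sp_su_real (R : realType) N (A B : 'M[R[i]]_N) :
  su A -> su B -> (complex.Re (sp A B))%:C = sp A B.
Proof.
move=> [hA _] [hB _]; apply: RRe_real; apply/CrealP.
have trJ (M : 'M[R[i]]_N) :
    Num.conj (\tr M) = \tr (map_mx Num.conj M^T).
  by rewrite trace_map_mx mxtrace_tr.
rewrite /sp rmorphM rmorphN fmorphV rmorph_nat.
congr (_ * _); apply: etrans (trJ _) _.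
rewrite trmx_mul map_mxM hA hB mulNmx mulmxN opprK.
by rewrite mxtrace_mulC.
Qed.

Section Frame.
Variables (R : realType) (N : nat) (V W : 'M[R[i]]_N).
Variable nu : 'I_(codim N) -> 'M[R[i]]_N.
Hypotheses (N2 : (2 <= N)%N) (trV : \tr V = 0) (trW : \tr W = 0).
Hypothesis trnu : forall j, \tr (nu j) = 0.
Hypothesis nuT : forall j, sp V (nu j) = 0 /\ sp W (nu j) = 0.
Hypothesis nu_on : forall j k, sp (nu j) (nu k) = (j == k)%:R.

Let G := sp V W.
Let det := sp V V * sp W W - G ^+ 2.
Hypothesis det_neq0 : det != 0.

Let frame (x : unit + (bool + 'I_(codim N))) : 'M[R[i]]_N :=
  match x with
  | inl _ => 1%:M
  | inr (inl b) => if b then V else W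
  | inr (inr j) => nu j
  end.

Lemma card_frame : #|{: unit + (bool + 'I_(codim N))}| = (N * N)%N.
Proof.
rewrite !card_sum card_unit card_bool card_ord /codim -mulnn.
(* The subtraction in [codim] is truncated, so [3 + (N ^ 2 - 3) = N ^ 2] requires a lower bound on
   [N ^ 2]. *)
have : (4 <= N * N)%N by rewrite (leq_mul N2 N2).
by move: (N * N)%N => [|[|[|k]]] // _; rewrite !subSS subn0.
Qed.

(** The Gram matrix of the frame is block diagonal. A kernel vector loses its identity component
    because [N] is nonzero, its normal components by orthonormality, and its two tangential
    components because [det] is nonzero. *)
Lemma frame_complete A : \tr A = 0 -> sp A V = 0 -> sp A W = 0 ->
  (forall j, sp A (nu j) = 0) -> A = 0.
Proof.
move=> trA AV AW Anu; apply: (@trace_form_generates _ _ _ frame).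
- exact: card_frame.
- move=> c cE.
  have sumE i : \sum_j c j * \tr (frame i *m frame j) =
      c (inl tt) * \tr (frame i) +
      (c (inr (inl true)) * \tr (frame i *m V) +
       c (inr (inl false)) * \tr (frame i *m W) +
       \sum_j c (inr (inr j)) * \tr (frame i *m nu j)).
    rewrite big_sumType /= (big_pred1 tt) /=; last by case.
    by rewrite big_sumType /= big_bool /= mulmx1.
  have N0 : N%:R != 0 :> R[i] by rewrite pnatr_eq0 -lt0n (ltn_trans _ N2).
  have two0 : - 2 != 0 :> R[i] by rewrite oppr_eq0 pnatr_eq0.
  have c1 : c (inl tt) = 0.
    have := cE (inl tt); rewrite sumE /= !mul1mx trV trW !mulr0 !add0r big1.
      rewrite addr0 mxtrace1 => /eqP.
      by rewrite mulf_eq0 (negPf N0) orbF => /eqP.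
    by move=> j _; rewrite mul1mx trnu mulr0.
  have cnu k : c (inr (inr k)) = 0.
    have := cE (inr (inr k)); rewrite sumE /= c1 mul0r add0r !mxtrace_sp.
    rewrite !(sp_sym (nu k)) (nuT k).1 (nuT k).2 !mulr0 !add0r (bigD1 k) //=.
    rewrite big1 ?addr0.
      rewrite mxtrace_sp nu_on eqxx mulr1 => /eqP.
      by rewrite mulf_eq0 (negPf two0) orbF => /eqP.
    by move=> j /negPf jk; rewrite mxtrace_sp nu_on eq_sym jk !mulr0.
  have sum0 (B : 'M[R[i]]_N) : \sum_j c (inr (inr j)) * \tr (B *m nu j) = 0.
    by rewrite big1 // => j _; rewrite cnu mul0r.
  have lin (B : 'M[R[i]]_N) a b :
      a * \tr (B *m V) + b * \tr (B *m W) = 0 -> a * sp B V + b * sp B W = 0.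
    rewrite !mxtrace_sp !(mulrCA _ (- 2)) -mulrDr => /eqP.
    by rewrite mulf_eq0 (negPf two0) => /eqP.
  have /lin E1 : c (inr (inl true)) * \tr (V *m V) +
                 c (inr (inl false)) * \tr (V *m W) = 0.
    by have := cE (inr (inl true)); rewrite sumE /= c1 sum0 mul0r add0r addr0.
  have /lin E2 : c (inr (inl true)) * \tr (W *m V) +
                 c (inr (inl false)) * \tr (W *m W) = 0.
    by have := cE (inr (inl false)); rewrite sumE /= c1 sum0 mul0r add0r addr0.
  rewrite (sp_sym W V) in E2.
  have [cV cW] := sym2_kernel det_neq0 E1 E2.
  by move=> [[]|[[]|k]].
- move=> [[]|[[]|j]] /=; rewrite ?mulmx1 // mxtrace_sp.
  + by rewrite AV mulr0.
  + by rewrite AW mulr0.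
  + by rewrite Anu mulr0.
Qed.

(** The tangential coefficients are the inverse of the metric applied to the products with [V] and
    [W], so the difference of the two sides is traceless and orthogonal to the whole frame;
    [frame_complete] applies. *)
Lemma frame_decomp A : \tr A = 0 ->
  A = ((sp W W * sp A V - G * sp A W) / det) *: V
    + ((sp V V * sp A W - G * sp A V) / det) *: W
    + \sum_j sp A (nu j) *: nu j.
Proof.
move=> trA.
have trS : \tr (\sum_j sp A (nu j) *: nu j) = 0.
  by rewrite raddf_sum big1 // => j _; rewrite /= mxtraceZ trnu mulr0.
apply/eqP; rewrite -subr_eq0; apply/eqP; apply: frame_complete.
- rewrite raddfB /= !raddfD /= !mxtraceZ trA trV trW !mulr0 !oppr0.
  by rewrite trS oppr0 !addr0.
- rewrite spDl spNl !spDl !spZl sp_suml big1; last first.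
    by move=> j _; rewrite spZl (sp_sym _ V) (nuT j).1 mulr0.
  by rewrite addr0 (sp_sym W V) /det /G; field; exact: det_neq0.
- rewrite spDl spNl !spDl !spZl sp_suml big1; last first.
    by move=> j _; rewrite spZl (sp_sym _ W) (nuT j).2 mulr0.
  by rewrite addr0 /det /G; field; exact: det_neq0.
- move=> j; rewrite spDl spNl !spDl !spZl sp_suml (bigD1 j) //= big1.
    rewrite spZl nu_on eqxx (nuT j).1 (nuT j).2.
    by rewrite !(mulr0, addr0, add0r, mulr1) addrN.
  by move=> k /negPf kj; rewrite spZl nu_on kj mulr0.
Qed.

Lemma frame_decomp_normal A : \tr A = 0 -> sp A V = 0 -> sp A W = 0 ->
  A = \sum_j sp A (nu j) *: nu j.
Proof.
move=> trA AV AW; rewrite [LHS]frame_decomp // AV AW.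
by rewrite !mulr0 subrr mul0r !scale0r !add0r.
Qed.

(** The form suited to derivatives of normal vectors, whose products with the tangent vectors are
    minus the second fundamental form coefficients [x] and [y]. *)
Lemma frame_decomp_opp A x y : \tr A = 0 -> sp A V = - x -> sp A W = - y ->
  A = ((y * G - x * sp W W) / det) *: V + ((x * G - y * sp V V) / det) *: W
    + \sum_j sp A (nu j) *: nu j.
Proof.
move=> trA AV AW; rewrite [LHS]frame_decomp // AV AW.
congr (_ / _ *: _ + _ / _ *: _ + _).
  by rewrite !mulrN opprK addrC (mulrC G) (mulrC (sp W W)).
by rewrite !mulrN opprK addrC (mulrC G) (mulrC (sp V V)).
Qed.

End Frame.

(** * Differentiation of complex matrices *)

(** Componentwise, to match [pd]. The predicate carries existence together with the value, so that
    product rules can be chained and values then compared by uniqueness. *)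
Definition is_cderive (R : realType) (v : plane R) (f : plane R -> R[i])
    (p : plane R) (d : R[i]) : Prop :=
  is_derive p v (fun q => complex.Re (f q)) (complex.Re d) /\
  is_derive p v (fun q => complex.Im (f q)) (complex.Im d).

Section ComplexDerivative.
Variables (R : realType) (v p : plane R).
Implicit Types (f g : plane R -> R[i]) (c d : R[i]).

Lemma is_cderive_cst c : is_cderive v (fun=> c) p 0.
Proof. by split; exact: is_derive_cst. Qed.

Lemma is_cderiveN f d :
  is_cderive v f p d -> is_cderive v (fun q => - f q) p (- d).
Proof.
move=> [dr di]; split.
- have -> : (fun q => complex.Re (- f q)) = - (fun q => complex.Re (f q)).
    by apply/funext => q; rewrite fctE; case: (f q).
  by have := is_deriveN dr; case: (d).
- have -> : (fun q => complex.Im (- f q)) = - (fun q => complex.Im (f q)).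
    by apply/funext => q; rewrite fctE; case: (f q).
  by have := is_deriveN di; case: (d).
Qed.

Lemma is_cderiveD f g d e : is_cderive v f p d -> is_cderive v g p e ->
  is_cderive v (fun q => f q + g q) p (d + e).
Proof.
move=> [fr fi] [gr gi]; split.
- have -> : (fun q => complex.Re (f q + g q)) =
            (fun q => complex.Re (f q)) + (fun q => complex.Re (g q)).
    by apply/funext => q; rewrite fctE; case: (f q); case: (g q).
  by have := is_deriveD fr gr; case: (d); case: (e).
- have -> : (fun q => complex.Im (f q + g q)) =
            (fun q => complex.Im (f q)) + (fun q => complex.Im (g q)).
    by apply/funext => q; rewrite fctE; case: (f q); case: (g q).
  by have := is_deriveD fi gi; case: (d); case: (e).
Qed.

Lemma is_cderiveM f g d e : is_cderive v f p d -> is_cderive v g p e ->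
  is_cderive v (fun q => f q * g q) p (d * g p + f p * e).
Proof.
move=> [fr fi] [gr gi]; split.
- have -> : (fun q => complex.Re (f q * g q)) =
      (fun q => complex.Re (f q)) * (fun q => complex.Re (g q)) -
      (fun q => complex.Im (f q)) * (fun q => complex.Im (g q)).
    by apply/funext => q; rewrite !fctE; case: (f q); case: (g q).
  apply: (is_derive_eq (is_deriveB (is_deriveM fr gr) (is_deriveM fi gi))).
  move: (f p) (g p) d e {fr fi gr gi} => [a b] [c d'] [x y] [z t] /=.
  rewrite /GRing.scale /=; ring.
- have -> : (fun q => complex.Im (f q * g q)) =
      (fun q => complex.Re (f q)) * (fun q => complex.Im (g q)) +
      (fun q => complex.Im (f q)) * (fun q => complex.Re (g q)).
    by apply/funext => q; rewrite !fctE; case: (f q); case: (g q).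
  apply: (is_derive_eq (is_deriveD (is_deriveM fr gi) (is_deriveM fi gr))).
  move: (f p) (g p) d e {fr fi gr gi} => [a b] [c d'] [x y] [z t] /=.
  rewrite /GRing.scale /=; ring.
Qed.

Lemma is_cderive_conj f d : is_cderive v f p d ->
  is_cderive v (fun q => Num.conj (f q)) p (Num.conj d).
Proof.
move=> [dr di]; split.
- have -> : (fun q => complex.Re (Num.conj (f q))) =
            (fun q => complex.Re (f q)).
    by apply/funext => q; case: (f q).
  by move: dr; case: (d).
- have -> : (fun q => complex.Im (Num.conj (f q))) =
            - (fun q => complex.Im (f q)).
    by apply/funext => q; rewrite fctE; case: (f q).
  by have := is_deriveN di; case: (d).
Qed.

Lemma is_cderive_sum n (f : 'I_n -> plane R -> R[i]) (d : 'I_n -> R[i]) :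
  (forall k, is_cderive v (f k) p (d k)) ->
  is_cderive v (fun q => \sum_k f k q) p (\sum_k d k).
Proof.
move=> fd; have -> : (fun q => \sum_k f k q) = \sum_k f k.
  by apply/funext => q; rewrite fct_sumE.
elim/big_ind2: _ => //; first exact: is_cderive_cst.
by move=> g e h x; exact: is_cderiveD.
Qed.

(** Derivatives are local, so an identity that holds on an open set can be differentiated there. *)
Lemma is_cderive_near (U : set (plane R)) f g d :
  open U -> U p -> (forall q, U q -> f q = g q) ->
  is_cderive v g p d -> is_cderive v f p d.
Proof.
move=> oU Up fg [dr di].
have N : \forall q \near p, f q = g q.
  by apply: filterS (open_nbhs_nbhs (conj oU Up)) => q; exact: fg.
split; [apply: near_eq_is_derive dr|apply: near_eq_is_derive di].
all: by near=> q; rewrite (near N q).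
Unshelve. all: by end_near. Qed.

Lemma is_cderive_uniq f d e :
  is_cderive v f p d -> is_cderive v f p e -> d = e.
Proof.
case: d e => [a b] [a' b'] [[_ /= <-] [_ /= <-]] [[_ /= <-] [_ /= <-]].
by [].
Qed.

End ComplexDerivative.

Definition is_pd (R : realType) (a b : nat) (B : bool)
    (F : plane R -> 'M[R[i]]_(a, b)) (p : plane R) (D : 'M[R[i]]_(a, b)) :=
  forall i j, is_cderive (lc_dir B) (fun q => F q i j) p (D i j).

Section MatrixDerivative.
Variables (R : realType) (B : bool) (p : plane R).

Lemma is_pd_pd a b (F : plane R -> 'M[R[i]]_(a, b)) D :
  is_pd B F p D -> pd B F p = D.
Proof.
move=> FD; apply/matrixP => i j; rewrite mxE; have [dr di] := FD i j.
by rewrite !derive_val; case: (D i j).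
Qed.

Lemma is_pd_cst a b (C : 'M[R[i]]_(a, b)) : is_pd B (fun=> C) p 0.
Proof. by move=> i j; rewrite mxE; exact: is_cderive_cst. Qed.

Lemma is_pdN a b (F : plane R -> 'M[R[i]]_(a, b)) D :
  is_pd B F p D -> is_pd B (fun q => - F q) p (- D).
Proof.
move=> FD i j; rewrite mxE.
have -> : (fun q => (- F q) i j) = (fun q => - F q i j).
  by apply/funext => q; rewrite mxE.
exact: is_cderiveN.
Qed.

Lemma is_pdD a b (F G : plane R -> 'M[R[i]]_(a, b)) D E :
  is_pd B F p D -> is_pd B G p E -> is_pd B (fun q => F q + G q) p (D + E).
Proof.
move=> FD GE i j; rewrite mxE.
have -> : (fun q => (F q + G q) i j) = (fun q => F q i j + G q i j).
  by apply/funext => q; rewrite mxE.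
exact: is_cderiveD.
Qed.

Lemma is_pdB a b (F G : plane R -> 'M[R[i]]_(a, b)) D E :
  is_pd B F p D -> is_pd B G p E -> is_pd B (fun q => F q - G q) p (D - E).
Proof. by move=> FD GE; apply: is_pdD => //; exact: is_pdN. Qed.

Lemma is_pdM a b c (F : plane R -> 'M[R[i]]_(a, b))
    (G : plane R -> 'M[R[i]]_(b, c)) D E :
  is_pd B F p D -> is_pd B G p E ->
  is_pd B (fun q => F q *m G q) p (D *m G p + F p *m E).
Proof.
move=> FD GE i j; rewrite !mxE -big_split /=.
have -> : (fun q => (F q *m G q) i j) = (fun q => \sum_k F q i k * G q k j).
  by apply/funext => q; rewrite mxE.
by apply: is_cderive_sum => k; exact: is_cderiveM.
Qed.

Lemma is_pd_dagger a b (F : plane R -> 'M[R[i]]_(a, b)) D :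
  is_pd B F p D -> is_pd B (dagger F) p (map_mx Num.conj D^T).
Proof.
move=> FD i j; rewrite !mxE.
have -> : (fun q => dagger F q i j) = (fun q => Num.conj (F q j i)).
  by apply/funext => q; rewrite !mxE.
exact: is_cderive_conj.
Qed.

Lemma is_pd_tr a (F : plane R -> 'M[R[i]]_a) D :
  is_pd B F p D -> is_cderive (lc_dir B) (fun q => \tr (F q)) p (\tr D).
Proof. by move=> FD; exact: is_cderive_sum. Qed.

Lemma is_pd_near a b (U : set (plane R)) (F G : plane R -> 'M[R[i]]_(a, b)) D :
  open U -> U p -> (forall q, U q -> F q = G q) ->
  is_pd B G p D -> is_pd B F p D.
Proof.
move=> oU Up FG GD i j; apply: is_cderive_near oU Up _ (GD i j) => q Uq.
by rewrite FG.
Qed.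

Lemma is_pd_uniq a b (F : plane R -> 'M[R[i]]_(a, b)) D E :
  is_pd B F p D -> is_pd B F p E -> D = E.
Proof. by move=> /is_pd_pd <- /is_pd_pd. Qed.

Lemma smooth_is_pd a b (U : set (plane R)) (F : plane R -> 'M[R[i]]_(a, b)) :
  smooth_mx U F -> U p -> is_pd B F p (pd B F p).
Proof.
move=> sF Up i j; have [[dr _] [di _]] := sF i j 1%N.
by rewrite mxE; split; apply/derivableP/diff_derivable; [exact: dr|exact: di].
Qed.

End MatrixDerivative.

Lemma sp_cst_derive (R : realType) (B : bool) N (U : set (plane R)) (c : R[i])
    (F G : plane R -> 'M[R[i]]_N) (p : plane R) :
  open U -> U p -> smooth_mx U F -> smooth_mx U G ->
  (forall q, U q -> sp (F q) (G q) = c) ->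
  sp (pd B F p) (G p) + sp (F p) (pd B G p) = 0.
Proof.
move=> oU Up sF sG FGc; rewrite /sp -mulrDr -mxtraceD.
have := is_pd_tr (is_pdM (smooth_is_pd B sF Up) (smooth_is_pd B sG Up)).
have : is_cderive (lc_dir B) (fun q => \tr (F q *m G q)) p 0.
  (* The constant is [- 2 * c] because the trace is [- 2] times the scalar product. *)
  apply: (is_cderive_near oU Up) (is_cderive_cst _ _ (- 2 * c)) => q Uq.
  by rewrite -(FGc _ Uq) mxtrace_sp.
by move=> + d2 => /is_cderive_uniq /(_ d2) <-; rewrite mulr0.
Qed.

Lemma smooth_pd (R : realType) a b (B : bool) (U : set (plane R))
    (F : plane R -> 'M[R[i]]_(a, b)) :
  smooth_mx U F -> smooth_mx U (pd B F).
Proof.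
move=> sF i j k; have [[_ cr] [_ ci]] := sF i j k.+1.
split.
- have -> : (fun p => complex.Re (pd B F p i j)) =
            'D_(lc_dir B) (fun q => complex.Re (F q i j)).
    by apply/funext => q; rewrite mxE.
  exact: cr.
- have -> : (fun p => complex.Im (pd B F p i j)) =
            'D_(lc_dir B) (fun q => complex.Im (F q i j)).
    by apply/funext => q; rewrite mxE.
  exact: ci.
Qed.

Lemma Ck_derive_comm (R : realType) (U : set (plane R)) (f : plane R -> R)
    (u v p : plane R) :
  open U -> U p -> Ck 2 U f -> 'D_u ('D_v f) p = 'D_v ('D_u f) p.
Proof.
move=> oU Up [df d2f]; apply: derive_comm.
- by apply: filterS (open_nbhs_nbhs (conj oU Up)) => q; exact: df.
- by have [+ _] := d2f u; exact.
- by have [+ _] := d2f v; exact.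
Qed.

Lemma pdE (R : realType) a b (B : bool) (F : plane R -> 'M[R[i]]_(a, b)) p i j :
  pd B F p i j = 'D_(lc_dir B) (fun q => complex.Re (F q i j)) p +i*
                 'D_(lc_dir B) (fun q => complex.Im (F q i j)) p.
Proof. by rewrite mxE. Qed.

Lemma pd_comm (R : realType) a b (B D : bool) (U : set (plane R))
    (F : plane R -> 'M[R[i]]_(a, b)) (p : plane R) :
  open U -> U p -> smooth_mx U F -> pd B (pd D F) p = pd D (pd B F) p.
Proof.
move=> oU Up sF; apply/matrixP => i j; have [cr ci] := sF i j 2%N.
have ER : 'D_(lc_dir B) (fun q => complex.Re (pd D F q i j)) p =
          'D_(lc_dir D) (fun q => complex.Re (pd B F q i j)) p.
  have E C : (fun q => complex.Re (pd C F q i j)) =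
      'D_(lc_dir C) (fun q => complex.Re (F q i j)).
    by apply/funext => q; rewrite pdE.
  rewrite (E B) (E D); exact: Ck_derive_comm oU Up cr.
have EI : 'D_(lc_dir B) (fun q => complex.Im (pd D F q i j)) p =
          'D_(lc_dir D) (fun q => complex.Im (pd B F q i j)) p.
  have E C : (fun q => complex.Im (pd C F q i j)) =
      'D_(lc_dir C) (fun q => complex.Im (F q i j)).
    by apply/funext => q; rewrite pdE.
  rewrite (E B) (E D); exact: Ck_derive_comm oU Up ci.
apply: etrans (pdE B (pd D F) p i j) _.
by rewrite ER EI -(pdE D (pd B F)).
Qed.

Lemma pd_su (R : realType) (B : bool) N (U : set (plane R))
    (F : plane R -> 'M[R[i]]_N) (p : plane R) :
  open U -> U p -> smooth_mx U F -> (forall q, U q -> su (F q)) ->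
  su (pd B F p).
Proof.
move=> oU Up sF suF; have FD := smooth_is_pd B sF Up; split.
- apply: (is_pd_uniq (is_pd_dagger FD)).
  by apply: is_pd_near oU Up _ (is_pdN FD) => q /suF [].
- apply: (is_cderive_uniq (is_pd_tr FD)).
  by apply: is_cderive_near oU Up _ (is_cderive_cst _ _ 0) => q /suF [].
Qed.

Lemma pd_dagger (R : realType) (B : bool) a b (U : set (plane R))
    (F : plane R -> 'M[R[i]]_(a, b)) (p : plane R) :
  smooth_mx U F -> U p -> pd B (dagger F) p = dagger (pd B F) p.
Proof.
by move=> sF Up; apply/is_pd_pd/is_pd_dagger; exact: smooth_is_pd sF Up.
Qed.

(** * The surface of a solution *)

(** The derivative of [Z] is plus the tangent matrix for L and minus it for R. The product of two
    such signs, halved, is the factor of the form Kronecker delta minus one half. *)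
Lemma sp_signed (R : realType) N (B D : bool) (S T : 'M[R[i]]_N) t :
  sp S T = 2^-1 * t ->
  sp (if B then S else - S) (if D then T else - T) = ((B == D)%:R - 2^-1) * t.
Proof.
by move=> E; case: B; case: D; rewrite ?spNl ?spNr ?opprK E /=; field.
Qed.

Lemma is_pd_signed (R : realType) a b (B C : bool)
    (F : plane R -> 'M[R[i]]_(a, b)) p D :
  is_pd B F p D ->
  is_pd B (fun q => if C then F q else - F q) p (if C then D else - D).
Proof. by case: C => //; exact: is_pdN. Qed.

Section SigmaModel.
Variables (R : realType) (N m : nat) (Omega : set (plane R)).
Variables (X : plane R -> 'M[R[i]]_(N, m)) (Z : plane R -> 'M[R[i]]_N).
Hypotheses (oO : open Omega) (solX : sigma_solution Omega X).
Hypothesis surfZ : associated_surface Omega X Z.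

Let Y := dagger X.
Let P := gproj X.

Let sX : smooth_mx Omega X. Proof. by case: solX. Qed.

Let YX q : Omega q -> Y q *m X q = 1%:M.
Proof. by case: solX => _ + _; apply. Qed.

Let dX B q : Omega q -> is_pd B X q (pd B X q).
Proof. exact: smooth_is_pd. Qed.

Let dY B q : Omega q -> is_pd B Y q (pd B Y q).
Proof.
by move=> Oq; rewrite /Y (pd_dagger B sX Oq); apply: is_pd_dagger; exact: dX.
Qed.

Let d2X B D q : Omega q -> is_pd B (pd D X) q (pd B (pd D X) q).
Proof. by apply: smooth_is_pd; exact: smooth_pd. Qed.

Let d2Y B D q : Omega q -> is_pd B (pd D Y) q (pd B (pd D Y) q).
Proof.
(* Dagger and derivative commute at points of [Omega]; as [Omega] is open, this suffices to
   differentiate once more. *)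
move=> Oq; have H : is_pd B (pd D Y) q (dagger (pd B (pd D X)) q).
  apply: is_pd_near oO Oq _ (is_pd_dagger (d2X B D Oq)) => r Or.
  exact: pd_dagger sX Or.
by rewrite (is_pd_pd H).
Qed.

Let dPval B q := - (pd B X q *m Y q + X q *m pd B Y q).

Let dP B q : Omega q -> is_pd B P q (dPval B q).
Proof.
move=> Oq; rewrite /dPval -[X in is_pd _ _ _ X]sub0r.
exact: is_pdB (is_pd_cst _ _ _) (is_pdM (dX B Oq) (dY B Oq)).
Qed.

Let constraint B q : Omega q -> Y q *m pd B X q + pd B Y q *m X q = 0.
Proof.
move=> Oq; rewrite addrC.
apply: (is_pd_uniq (is_pdM (dY B Oq) (dX B Oq))).
by apply: is_pd_near oO Oq _ (is_pd_cst _ _ 1%:M) => r /YX.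
Qed.

Let T B q := tangent (P q) (X q) (Y q) (pd B X q) (pd B Y q).

Let bracket_dP B q : Omega q -> bracket (pd B P q) (P q) = T B q.
Proof.
move=> Oq; rewrite (is_pd_pd (dP B Oq)) /bracket.
exact: bracket_tangent (YX Oq) (erefl _) _ _.
Qed.

Let pdZ B q : Omega q -> pd B Z q = if B then T B q else - T B q.
Proof.
case: surfZ => _ _ ZL ZR Oq; case: B.
  exact: etrans (ZL q Oq) (bracket_dP true Oq).
by rewrite (ZR q Oq) -(bracket_dP false Oq).
Qed.

Let dT B q : Omega q -> is_pd B (T B) q
  (dtangent (P q) (X q) (Y q) (pd B X q) (pd B Y q)
     (pd B (pd B X) q) (pd B (pd B Y) q)).
Proof.
move=> Oq; apply: is_pdB.
  exact: is_pdM (is_pdM (dP B Oq) (d2X B B Oq)) (dY B Oq).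
exact: is_pdM (is_pdM (dX B Oq) (d2Y B B Oq)) (dP B Oq).
Qed.

Lemma sp_pdZ B D p : Omega p ->
  sp (pd B Z p) (pd D Z p) = ((B == D)%:R - 2^-1) *
    \tr ((pd B X p *m pd D Y p + pd D X p *m pd B Y p) *m P p).
Proof.
move=> Op; rewrite !pdZ //.
apply: sp_signed.
by rewrite /sp (tr_tangentM (YX Op) (erefl _)) mulrNN.
Qed.

Lemma sp_pdZ_diag B p : Omega p ->
  sp (pd B Z p) (pd B Z p) = \tr (pd B X p *m pd B Y p *m P p).
Proof.
move=> Op; rewrite sp_pdZ // eqxx mulmxDl mxtraceD.
by move: (\tr _) => t /=; field.
Qed.

Lemma sp_pd2Z B D p : Omega p ->
  sp (pd B (pd B Z) p) (pd D Z p) = ((B == D)%:R - 2^-1) *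
    \tr ((pd B (pd B X) p *m pd D Y p + pd D X p *m pd B (pd B Y) p) *m P p
         + 2 *: (pd B X p *m pd B Y p *m (X p *m pd D Y p + pd D X p *m Y p))).
Proof.
move=> Op; rewrite (pdZ D) //.
rewrite (is_pd_pd (is_pd_near oO Op (pdZ B) (is_pd_signed B (dT B Op)))).
apply: sp_signed.
rewrite /sp (tr_dtangentM (YX Op) (erefl _)) ?mulrNN //; exact: constraint.
Qed.

Lemma pd_mixedZ p : Omega p ->
  dL (dR Z) p = bracket (dL P p) (dR P p).
Proof.
case: solX surfZ => _ _ EL [_ _ _ ZR] Op.
(* [pd] has a value even where no derivative exists, so differentiability of [dR P] is first derived
   from the product rule on [Omega]. *)
have dRP : is_pd true (dR P) p (dL (dR P) p).
  have H := is_pdN (is_pdD (is_pdM (d2X true false Op) (dY true Op))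
                           (is_pdM (dX true Op) (d2Y true false Op))).
  have {}H : is_pd true (dR P) p _ :=
    is_pd_near oO Op (fun q Oq => is_pd_pd (dP false Oq)) H.
  by rewrite (is_pd_pd H).
have dLP : is_pd true P p (dL P p).
  by rewrite (is_pd_pd (dP true Op)); exact: dP.
have H := is_pdN (is_pdB (is_pdM dRP dLP) (is_pdM dLP dRP)).
have {}H : is_pd true (dR Z) p _ := is_pd_near oO Op ZR H.
rewrite (is_pd_pd H) /bracket.
(* Differentiating [- [dR P, P]] gives [- [dL dR P, P] - [dR P, dL P]]; the Euler-Lagrange equation
   removes the first bracket. *)
have /subr0_eq := EL p Op; rewrite -/P => ->.
by rewrite opprB opprD addrA addrK.
Qed.

Lemma sp_pd_mixedZ D p : Omega p -> sp (dL (dR Z) p) (pd D Z p) = 0.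
Proof.
move=> Op; rewrite pd_mixedZ // pdZ // -bracket_dP // /bracket.
have off B : pd B P p *m P p + P p *m pd B P p = pd B P p.
  rewrite (is_pd_pd (dP B Op)).
  exact: tangent_offdiag (YX Op) (erefl _) _ _ (constraint B Op).
have sp0 : sp (dL P p *m dR P p - dR P p *m dL P p)
    (pd D P p *m P p - P p *m pd D P p) = 0.
  rewrite /sp tr_commute_bracket ?mulr0 //.
  exact: offdiag_bracket_comm.
by case: D sp0 => E; rewrite ?spNr E ?oppr0.
Qed.

End SigmaModel.

(** * Gauss-Weingarten equations for the moving frame *)

Lemma Ck_sub (R : realType) k (U V : set (plane R)) (f : plane R -> R) :
  V `<=` U -> Ck k U f -> Ck k V f.
Proof.
move=> VU; elim: k f => [|k IH] f /=; first by move=> cf p /VU; exact: cf.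
by move=> [df cf]; split=> [p /VU|v]; [exact: df|exact: IH].
Qed.

Theorem mainTheorem3 (R : realType) (m n : nat) (Omega Upsilon : set (plane R))
    (xiL0 xiR0 : R)
    (X : plane R -> 'M[R[i]]_(m + n, m)) (Z : plane R -> 'M[R[i]]_(m + n))
    (nu : 'I_(codim (m + n)) -> plane R -> 'M[R[i]]_(m + n)) :
  (1 <= m)%N -> (1 <= n)%N ->
  open Omega -> connected Omega -> simply_connected Omega ->
  sigma_solution Omega X ->
  associated_surface Omega X Z ->
  open Upsilon -> Upsilon (light_cone xiL0 xiR0) -> Upsilon `<=` Omega ->
  (forall p, Upsilon p -> detG Z p != 0) ->
  (forall k, smooth_mx Upsilon (nu k)) ->
  (forall k p, Upsilon p -> su (nu k p)) ->
  (forall k p, Upsilon p ->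
     sp (dL Z p) (nu k p) = 0 /\ sp (dR Z p) (nu k p) = 0) ->
  (forall j k p, Upsilon p -> sp (nu j p) (nu k p) = (j == k)%:R) ->
  exists (H QL QR : 'I_(codim (m + n)) -> plane R -> R)
         (sL sR : 'I_(codim (m + n)) -> 'I_(codim (m + n)) -> plane R -> R),
  forall p, Upsilon p ->
    (forall j k, sL j k p + sL k j p = 0) /\
    (forall j k, sR j k p + sR k j p = 0) /\
    (* Gauss-Weingarten equations *)
    dL (dL Z) p = ALL Z p *: dL Z p + ALR Z p *: dR Z p
                  + \sum_j (QL j p)%:C *: nu j p /\
    dL (dR Z) p = \sum_j (H j p)%:C *: nu j p /\
    dR (dL Z) p = \sum_j (H j p)%:C *: nu j p /\
    dR (dR Z) p = ARL Z p *: dL Z p + ARR Z p *: dR Z p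
                  + \sum_j (QR j p)%:C *: nu j p /\
    (forall j, dL (nu j) p =
       (((H j p)%:C * GLR Z p - (QL j p)%:C * JR Z p) / detG Z p) *: dL Z p
       + (((QL j p)%:C * GLR Z p - (H j p)%:C * JL Z p) / detG Z p) *: dR Z p
       + \sum_k (sL j k p)%:C *: nu k p) /\
    (forall j, dR (nu j) p =
       (((QR j p)%:C * GLR Z p - (H j p)%:C * JR Z p) / detG Z p) *: dL Z p
       + (((H j p)%:C * GLR Z p - (QR j p)%:C * JL Z p) / detG Z p) *: dR Z p
       + \sum_k (sR j k p)%:C *: nu k p) /\
    (* the metric and the remaining scalar products in terms of X *)
    JL Z p = \tr (dL X p *m dL (dagger X) p *m gproj X p) /\
    JR Z p = \tr (dR X p *m dR (dagger X) p *m gproj X p) /\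
    GLR Z p = - (2^-1) *
      \tr ((dL X p *m dR (dagger X) p + dR X p *m dL (dagger X) p)
           *m gproj X p) /\
    (forall B D : bool,
       sp (pd B (pd B Z) p) (pd D Z p) =
       ((B == D)%:R - 2^-1) *
       \tr ((pd B (pd B X) p *m pd D (dagger X) p
             + pd D X p *m pd B (pd B (dagger X)) p) *m gproj X p
            + 2 *: (pd B X p *m pd B (dagger X) p
                    *m (X p *m pd D (dagger X) p
                        + pd D X p *m dagger X p)))).
Proof.
move=> m1 n1 oO _ _ solX surfZ oU _ UO det0 snu sunu nuT nu_on.
have [sZ suZ _ _] := surfZ.
have sdZ D : smooth_mx Upsilon (pd D Z).
  by move=> i j k; have [] := smooth_pd D sZ i j k; split; apply: Ck_sub UO _.
(* Each coefficient is the scalar product of the differentiated frame vector with a normal. All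
   matrices involved lie in su(N), so these products are real and taking [complex.Re] loses
   nothing. *)
exists (fun j p => complex.Re (sp (dL (dR Z) p) (nu j p))),
  (fun j p => complex.Re (sp (dL (dL Z) p) (nu j p))),
  (fun j p => complex.Re (sp (dR (dR Z) p) (nu j p))),
  (fun j k p => complex.Re (sp (dL (nu j) p) (nu k p))),
  (fun j k p => complex.Re (sp (dR (nu j) p) (nu k p))) => p Up.
have Op := UO p Up.
have su1 D q (Uq : Upsilon q) : su (pd D Z q).
  exact: pd_su oO (UO _ Uq) sZ suZ.
have su2 B D : su (pd B (pd D Z) p) by exact: pd_su oU Up (sdZ D) (su1 D).
have sun B j : su (pd B (nu j) p) by exact: pd_su oU Up (snu j) (sunu j).
have N2 : (2 <= m + n)%N by rewrite (leq_add m1 n1).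
have trZ D := (su1 D p Up).2.
have trnu j := (sunu j p Up).2.
have nuTp j := nuT j p Up.
have nu_onp j k := nu_on j k p Up.
have decomp :=
  frame_decomp N2 (trZ true) (trZ false) trnu nuTp nu_onp (det0 p Up).
have decomp_normal :=
  frame_decomp_normal N2 (trZ true) (trZ false) trnu nuTp nu_onp (det0 p Up).
have decomp_opp :=
  frame_decomp_opp N2 (trZ true) (trZ false) trnu nuTp nu_onp (det0 p Up).
(* Antisymmetry of the [s] coefficients is the derivative of orthonormality. *)
have anti B j k :
    sp (pd B (nu j) p) (nu k p) + sp (pd B (nu k) p) (nu j p) = 0.
  rewrite [X in _ + X]sp_sym.
  exact: sp_cst_derive oU Up (snu j) (snu k) (nu_on j k).
(* The derivative of [(dD Z, nu j) = 0] expresses the tangential products of a differentiated normal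
   through the second derivatives of [Z]. *)
have shape B D j :
    sp (pd B (nu j) p) (pd D Z p) = - sp (pd B (pd D Z) p) (nu j p).
  have ND q : Upsilon q -> sp (pd D Z q) (nu j q) = 0.
    by move=> /(nuT j) []; case: D.
  apply/eqP; rewrite -addr_eq0 addrC (sp_sym (pd B (nu j) p)); apply/eqP.
  exact: sp_cst_derive oU Up (sdZ D) (snu j) ND.
have mixed : dR (dL Z) p = dL (dR Z) p by exact: pd_comm oO Op sZ.
have reE B D j : (complex.Re (sp (pd B (pd D Z) p) (nu j p)))%:C =
    sp (pd B (pd D Z) p) (nu j p) by exact: sp_su_real (sunu j p Up).
have renE B j k : (complex.Re (sp (pd B (nu j) p) (nu k p)))%:C =
    sp (pd B (nu j) p) (nu k p) by exact: sp_su_real (sunu k p Up).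
have sumE B D : \sum_j (complex.Re (sp (pd B (pd D Z) p) (nu j p)))%:C *: nu j p
    = \sum_j sp (pd B (pd D Z) p) (nu j p) *: nu j p.
  by apply: eq_bigr => j _; rewrite reE.
have mixedE : dL (dR Z) p =
    \sum_j (complex.Re (sp (dL (dR Z) p) (nu j p)))%:C *: nu j p.
  rewrite sumE.
  exact: decomp_normal (su2 true false).2 (sp_pd_mixedZ oO solX surfZ true Op)
    (sp_pd_mixedZ oO solX surfZ false Op).
have realD0 (x y : R) : x%:C + y%:C = 0 :> R[i] -> x + y = 0 by case.
(* Both Weingarten equations at once: [(x, y)] is [(QL j, H j)] in the L direction and [(H j, QR j)]
   in the R direction, the latter by symmetry of the mixed derivative. *)
have normal B j x y :
    sp (pd B (dL Z) p) (nu j p) = x%:C -> sp (pd B (dR Z) p) (nu j p) = y%:C ->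
    pd B (nu j) p =
    ((y%:C * GLR Z p - x%:C * JR Z p) / detG Z p) *: dL Z p +
    ((x%:C * GLR Z p - y%:C * JL Z p) / detG Z p) *: dR Z p +
    \sum_k (complex.Re (sp (pd B (nu j) p) (nu k p)))%:C *: nu k p.
  move=> Ex Ey; under [in RHS]eq_bigr => k _ do rewrite renE.
  apply: decomp_opp (sun B j).2 _ _.
    by rewrite (shape B true) Ex.
  by rewrite (shape B false) Ey.
split; [|split; [|split; [|split; [|split; [|split; [|split; [|split; [|
  split; [|split; [|split]]]]]]]]]].
- by move=> j k; apply: realD0; rewrite !renE; exact: anti.
- by move=> j k; apply: realD0; rewrite !renE; exact: anti.
- rewrite (sumE true true).
  exact: (decomp _ (su2 true true).2).
- exact: mixedE.
- by rewrite mixed.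
- rewrite (sumE false false).
  exact: (decomp _ (su2 false false).2).
- by move=> j; apply: normal; [exact: esym (reE true true j)|
    exact: esym (reE true false j)].
- move=> j; apply: normal; last exact: esym (reE false false j).
  by rewrite mixed; exact: esym (reE true false j).
- by rewrite /JL (sp_pdZ_diag solX surfZ true Op).
- by rewrite /JR (sp_pdZ_diag solX surfZ false Op).
- rewrite /GLR (sp_pdZ solX surfZ true false Op).
  by congr (_ * _); rewrite sub0r.
- by move=> B D; exact: (sp_pd2Z oO solX surfZ).
Qed.
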